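(* There is an absolute constant $C>0$ such that for every $p\in(0,1)$ the following holds. Let $G_p$ be the random graph on $n$ vertices in which each edge is present independently with probability $p$. Then $$\Pr\left[\mathrm{boolw}(G_p)\le C\,\frac{\ln^2 n}{p}\right]\longrightarrow 1\quad\text{as } n\to\infty ;$$ that is, almost surely $\mathrm{boolw}(G_p)=O\left(\frac{\ln^2 n}{p}\right)$.
   Context: Graphs are undirected and without loops. For a vertex subset $A\subseteq V(G)$ let $\overline{A}=V(G)\setminus A$, and for $X\subseteq A$ consider the set $N(X)\cap\overline{A}$ of vertices of $\overline{A}$ having at least one neighbor in $X$. Define $$\mathrm{cutbool}(A)=\log_2\left|\{N(X)\cap\overline{A} : X\subseteq A\}\right| ,$$ which is known to be symmetric: $\mathrm{cutbool}(A)=\mathrm{cutbool}(\overline{A})$. A decomposition tree of $G$ is a pair $(T,\delta)$ where $T$ is a tree whose internal nodes all have degree three and which has $|V(G)|$ leaves, and $\delta$ is a bijection between $V(G)$ and the leaves of $T$. Each edge of $T$ defines a cut $\{A,\overline{A}\}$ of $G$: the two parts are the vertices corresponding to the leaves of the two subtrees obtained by removing the edge. The boolean-width $\mathrm{boolw}(T,\delta)$ of the decomposition tree is the maximum of $\mathrm{cutbool}(A)$ over all cuts $\{A,\overline{A}\}$ given by edges of $T$. The boolean-width $\mathrm{boolw}(G)$ is the minimum of $\mathrm{boolw}(T,\delta)$ over all decomposition trees of $G$. ''Almost surely'' means with probability tending to $1$ as $n\to\infty$. *)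

(* Defs.v *)
From mathcomp Require Import all_boot all_order all_algebra.
From mathcomp Require Import all_classical all_reals all_analysis.

Set Implicit Arguments.
Unset Strict Implicit.
Unset Printing Implicit Defensive.

Import Order.TTheory GRing.Theory Num.Theory.
Import numFieldNormedType.Exports.

Local Open Scope ring_scope.

(* A simple graph is its set of edges, an edge being a two-element set of
   vertices: there are no loops and no multiple edges. *)
Definition sgraph (V : finType) : Type :=
  {E : {set {set V}} | [forall e in E, #|e| == 2%N]}.

Definition adj (V : finType) (G : sgraph V) : rel V :=
  fun x y => [set x; y] \in val G.

Definition degree (V : finType) (G : sgraph V) (x : V) : nat :=
  #|[set y | adj G x y]|.

Definition is_tree (V : finType) (G : sgraph V) : Prop :=
  [/\ (0 < #|V|)%N,
      forall x y : V, connect (adj G) x y &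
      (* [ucycle] also accepts [:: x; y] (an edge walked back and forth) *)
      forall c : seq V, ucycle (adj G) c -> (size c < 3)%N].

(* The degree bound 1, instead of equality, only matters for the one-node tree,
   which is the decomposition tree of a one-vertex graph. *)
Definition leaf (V : finType) (G : sgraph V) : {set V} :=
  [set x | (degree G x <= 1)%N].

Record decomposition_tree (V : finType) := DecompositionTree {
  dt_node : finType;
  dt_tree : sgraph dt_node;
  dt_map : V -> dt_node;
  dt_is_tree : is_tree dt_tree;
  dt_internal : forall t, t \notin leaf dt_tree -> degree dt_tree t = 3%N;
  dt_map_inj : injective dt_map;
  dt_map_leaf : [set dt_map v | v : V] = leaf dt_tree
}.

Definition neighbours (V : finType) (G : sgraph V) (X : {set V}) : {set V} :=
  [set y | [exists x in X, adj G x y]].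

Definition cutbool (R : realType) (V : finType) (G : sgraph V) (A : {set V}) : R :=
  ln (#|[set neighbours G X :&: ~: A | X in powerset A]|%:R) / ln 2.

(* The part, containing the leaves on the side of [s], of the cut given by the
   edge {s, t} of the tree; the other part is [dt_cut D t s]. *)
Definition dt_cut (V : finType) (D : decomposition_tree V) (s t : dt_node D) :
    {set V} :=
  [set v | connect (fun x y => adj (dt_tree D) x y && ([set x; y] != [set s; t]))
             s (dt_map D v)].

(* Both parts of every cut are taken, so that no orientation has to be chosen;
   [cutbool] is nonnegative, so the neutral element 0 is harmless. *)
Definition boolw_tree (R : realType) (V : finType) (G : sgraph V)
    (D : decomposition_tree V) : R :=
  \big[Num.max/0]_(st : dt_node D * dt_node D | adj (dt_tree D) st.1 st.2)
    cutbool R G (dt_cut st.1 st.2).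

(* The infimum is a minimum, see [boolw_attained] and [boolw_le]. *)
Definition boolw (R : realType) (V : finType) (G : sgraph V) : R :=
  inf [set w | exists D : decomposition_tree V, w = boolw_tree R G D]%classic.

Lemma cutbool_ge0 (R : realType) (V : finType) (G : sgraph V) (A : {set V}) :
  0 <= cutbool R G A.
Proof.
rewrite /cutbool; apply: divr_ge0; apply: ln_ge0; rewrite ?ler1n //.
by apply/card_gt0P; exists (neighbours G finset.set0 :&: ~: A);
  apply/imsetP; exists finset.set0; rewrite // powersetE finset.sub0set.
Qed.

Lemma boolw_tree_ge0 (R : realType) (V : finType) (G : sgraph V)
    (D : decomposition_tree V) : 0 <= boolw_tree R G D.
Proof.
rewrite /boolw_tree; elim/big_ind: _ => // [x y x0 y0|st _].
  by rewrite le_max x0.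
exact: cutbool_ge0.
Qed.

Lemma boolw_le (R : realType) (V : finType) (G : sgraph V)
    (D : decomposition_tree V) : boolw R G <= boolw_tree R G D.
Proof.
apply: ge_inf; last by exists D.
by exists 0 => _ [D' ->]; exact: boolw_tree_ge0.
Qed.

Lemma boolw_tree_cutbool (R : realType) (V : finType) (G : sgraph V)
    (D : decomposition_tree V) :
  exists A : option {set V}, boolw_tree R G D = oapp (cutbool R G) 0 A.
Proof.
rewrite /boolw_tree; elim/big_ind: _ => [|x y [A ->] [B ->]|st _].
- by exists None.
- by case: leP => _; [exists B|exists A].
- by exists (Some (dt_cut st.1 st.2)).
Qed.

Lemma boolw_attained (R : realType) (V : finType) (G : sgraph V) :
  inhabited (decomposition_tree V) ->
  exists D : decomposition_tree V, boolw R G = boolw_tree R G D.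
Proof.
move=> [D0].
pose val_of (A : option {set V}) : R := oapp (cutbool R G) 0 A.
pose P (A : option {set V}) := `[< exists D, boolw_tree R G D = val_of A >].
have [A0 HA0] := boolw_tree_cutbool R G D0.
have PA0 : P A0 by apply/asboolP; exists D0.
case: (@Order.TotalTheory.arg_minP _ _ _ A0 P val_of PA0) => A /asboolP[D DA] Amin.
exists D; apply/le_anti; rewrite boolw_le /=.
apply: lb_le_inf; first by exists (boolw_tree R G D0), D0.
move=> _ [D' ->]; have [A' HA'] := boolw_tree_cutbool R G D'.
by rewrite DA HA'; apply: Amin; apply/asboolP; exists D'.
Qed.

(* The Erdos-Renyi distribution: a product of Bernoulli distributions, one for
   each of the two-element subsets of the vertex set. *)
Definition gnp_pmf (R : realType) (n : nat) (p : R) (G : sgraph 'I_n) : R :=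
  \prod_(e : {set 'I_n} | #|e| == 2%N) (if e \in val G then p else 1 - p).

Definition gnp_prob (R : realType) (n : nat) (p : R)
    (P : pred (sgraph 'I_n)) : R :=
  \sum_(G : sgraph 'I_n | P G) gnp_pmf p G.

Lemma gnp_prob1 (R : realType) (n : nat) (p : R) :
  gnp_prob p (fun _ : sgraph 'I_n => true) = 1.
Proof.
pose F (e : {set 'I_n}) : R := if #|e| == 2%N then p else 0.
pose H (e : {set 'I_n}) : R := if #|e| == 2%N then 1 - p else 1.
transitivity (\prod_(e : {set 'I_n}) (F e + H e)); last first.
  by rewrite big1 // => e _; rewrite /F /H; case: ifP => _; rewrite ?add0r // addrC subrK.
rewrite bigA_distr.
rewrite (bigID (fun E : {set {set 'I_n}} => [forall e in E, #|e| == 2%N])) /=.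
rewrite [X in _ + X]big1 ?addr0; last first.
  move=> E /forall_inPn[e eE /negbTE ne].
  by rewrite (bigD1 e) //= eE /F ne mul0r.
rewrite /gnp_prob.
rewrite [RHS](reindex_omap (val : sgraph 'I_n -> _) insub); last first.
  by move=> E hE; rewrite insubT.
apply: eq_big => [G|G _]; first by rewrite (valP G) valK eqxx.
rewrite /gnp_pmf big_mkcond /=; apply: eq_bigr => e _; rewrite /F /H.
have [//|ne] := eqVneq #|e| 2%N.
case: ifP => // eG; have /forall_inP/(_ _ eG) := valP G.
by rewrite (negbTE ne).
Qed.

(* Main.v *)
Require Import Defs.
From mathcomp Require Import all_boot all_order all_algebra.
From mathcomp Require Import all_classical all_reals all_analysis.

Import Order.TTheory GRing.Theory Num.Theory.
Import numFieldNormedType.Exports.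

Local Open Scope ring_scope.

(** The bound holds for every decomposition tree at once, because almost surely
    every vertex subset has boolean cut value O(ln^2 n / p).

    Call a bihole of order k a pair of disjoint sets of k vertices each with no
    edge between them.  In a graph without biholes of order k, the neighbourhood
    of X inside the complement of A is determined by fewer than k vertices: by X
    itself if |X| < k, and otherwise by the vertices of the complement of A that
    it misses, since k of them together with k vertices of X would form a
    bihole.  Hence a cut has at most 2 n^k <= n^(k+1) neighbourhoods
    ([card_traces_le]), and its cutbool is at most (k + 1) log_2 n.

    A given pair of disjoint k-sets is a bihole of G_p with probability
    (1 - p)^(k^2), as the k^2 potential edges between the sets are independent
    ([gnp_prob_avoids]).  There are at most n^(2k) pairs, so by the union bound
    a bihole of order k exists with probability at most (n^2 (1 - p)^k)^k
    ([gnp_prob_bihole_le]).  Since 1 - p <= exp(-p), the choice of k just above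
    3 ln n / p makes n^2 (1 - p)^k at most 1/n.  With probability at least
    1 - 1/n there is then no bihole of order k, and every decomposition tree has
    boolean-width at most (k + 1) log_2 n = O(ln^2 n / p). *)

(** * Counting small sets *)

Lemma bin_le_expn n k : ('C(n, k) <= n ^ k)%N.
Proof.
apply: (@leq_trans (n ^_ k)); first by rewrite -bin_ffact leq_pmulr ?fact_gt0.
elim: k => // k IHk; rewrite ffactnSr expnSr.
by apply: leq_mul => //; exact: leq_subr.
Qed.

Lemma card_small_sets_le (V : finType) k :
  (1 < #|V|)%N -> (#|[set X : {set V} | (#|X| < k)%N]| <= #|V| ^ k)%N.
Proof.
move=> V2; elim: k => [|k IHk].
  have -> : [set X : {set V} | (#|X| < 0)%N] = finset.set0.
    by apply/setP => X; rewrite !inE.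
  by rewrite cards0.
have -> : [set X : {set V} | (#|X| < k.+1)%N] =
    [set X : {set V} | (#|X| < k)%N] :|: [set X : {set V} | #|X| == k].
  by apply/setP => X; rewrite !inE ltnS leq_eqVlt orbC.
apply: leq_trans (leq_card_setU _ _) _; rewrite card_draws expnS.
apply: (@leq_trans (2 * #|V| ^ k)); last by rewrite leq_mul2r V2 orbT.
by rewrite mul2n -addnn leq_add // bin_le_expn.
Qed.

Lemma subset_of_size {V : finType} {X : {set V}} {k : nat} :
  (k <= #|X|)%N -> exists2 Y : {set V}, Y \subset X & #|Y| = k.
Proof.
rewrite -bin_gt0 -cards_draws => /card_gt0P[Y].
by rewrite inE => /andP[YX /eqP Yk]; exists Y.
Qed.

(** * Cuts of graphs without biholes *)

Definition cross_pairs {V : finType} (X Y : {set V}) : {set {set V}} :=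
  [set [set x; y] | x in X, y in Y].

Lemma card_cross_pair (V : finType) (X Y : {set V}) e :
  [disjoint X & Y] -> e \in cross_pairs X Y -> #|e| = 2%N.
Proof.
move=> dXY /imset2P[x y xX yY ->]; rewrite cards2; case: eqVneq => // xy.
by rewrite xy (disjointFl dXY yY) in xX.
Qed.

Lemma card_cross_pairs (V : finType) (X Y : {set V}) :
  [disjoint X & Y] -> #|cross_pairs X Y| = (#|X| * #|Y|)%N.
Proof.
move=> dXY; rewrite /cross_pairs curry_imset2X card_in_imset ?cardsX //.
move=> [x y] [x' y'] /setXP[/= xX yY] /setXP[/= x'X y'Y] exy.
have ne a b : a \in X -> b \in Y -> (a == b) = false.
  by move=> aX bY; apply/eqP => ab; rewrite ab (disjointFl dXY bY) in aX.
have := set21 x y; rewrite exy !inE (ne x y') // orbF => /eqP ->.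
by have := set22 x y; rewrite exy !inE eq_sym (ne x' y) //= => /eqP ->.
Qed.

Definition is_bihole {V : finType} k (G : sgraph V) (XY : {set V} * {set V}) :=
  [&& #|XY.1| == k, #|XY.2| == k, [disjoint XY.1 & XY.2] &
      [disjoint val G & cross_pairs XY.1 XY.2]].

Definition has_bihole {V : finType} k (G : sgraph V) :=
  [exists XY : {set V} * {set V}, is_bihole k G XY].

Section BiholeFree.
Variables (V : finType) (G : sgraph V) (k : nat).
Hypothesis no_bihole : ~~ has_bihole k G.

(** Otherwise k of the missed vertices and k vertices of X form a bihole. *)
Lemma card_non_neighbours_lt (X Y : {set V}) :
  (k <= #|X|)%N -> [disjoint X & Y] -> (#|Y :\: neighbours G X| < k)%N.
Proof.
move=> kX dXY; rewrite ltnNge; apply: contra no_bihole => kY.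
have [X' X'X X'k] := subset_of_size kX; have [Y' Y'Y Y'k] := subset_of_size kY.
apply/existsP; exists (X', Y'); rewrite /is_bihole /= X'k Y'k !eqxx /=.
apply/andP; split.
  rewrite (disjointWl X'X) // (disjointWr (B := Y)) //.
  by rewrite (fintype.subset_trans Y'Y) // subsetDl.
apply/pred0Pn => -[e /andP[/= eG /imset2P[x y xX' yY' xy_e]]].
rewrite xy_e in eG.
have := fintype.subsetP Y'Y _ yY'; rewrite !inE => /andP[/exists_inP[]].
by exists x => //; exact: (fintype.subsetP X'X).
Qed.

(** Small sets X index their own traces; the trace of a large X is indexed by
    its complement in ~: A, which has fewer than k vertices. *)
Lemma card_traces_le (A : {set V}) : (1 < #|V|)%N ->
  (#|[set neighbours G X :&: ~: A | X in powerset A]| <= #|V| ^ k.+1)%N.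
Proof.
move=> V2; pose small := [set X : {set V} | (#|X| < k)%N].
apply: (@leq_trans #|[set neighbours G X :&: ~: A | X in small]
                     :|: [set ~: A :\: Y | Y in small]|).
  apply/subset_leq_card/fintype.subsetP => _ /imsetP[X XA ->].
  rewrite powersetE in XA; rewrite inE; have [Xk|kX] := ltnP #|X| k.
    by apply/orP; left; apply/imsetP; exists X; rewrite ?inE.
  apply/orP; right; apply/imsetP; exists (~: A :\: neighbours G X).
    rewrite inE card_non_neighbours_lt //.
    by rewrite -finset.subsets_disjoint.
  by rewrite finset.setDDr finset.setDv finset.set0U finset.setIC.
apply: leq_trans (leq_card_setU _ _) _; rewrite expnS.
apply: (@leq_trans (2 * #|V| ^ k)); last by rewrite leq_mul2r V2 orbT.
rewrite mul2n -addnn; have small_le := card_small_sets_le V k V2.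
by apply: leq_add; apply: leq_trans (leq_imset_card _ _) _.
Qed.

Lemma boolw_no_bihole (R : realType) : (1 < #|V|)%N ->
  boolw R G <= k.+1%:R * ln #|V|%:R / ln 2.
Proof.
move=> V2; have V1 : 1 <= #|V|%:R :> R by rewrite ler1n ltnW.
have ln2_gt0 : 0 < ln 2 :> R by rewrite ln_gt0 // ltr1n.
have bound_ge0 : 0 <= k.+1%:R * ln #|V|%:R / ln 2 :> R.
  by rewrite divr_ge0 ?(ltW ln2_gt0) // mulr_ge0 // ln_ge0.
(* Were there no decomposition tree, the infimum would be 0 by convention. *)
have [[D]|noD] := pselect (inhabited (decomposition_tree V)); last first.
  rewrite /boolw (_ : [set _ | _]%classic = classical_sets.set0) ?inf0 //.
  by apply/seteqP; split => // w [D _]; case: noD; exists.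
apply: le_trans (boolw_le R G D) _; apply: bigmax_le => // st _.
rewrite ler_pM2r ?invr_gt0 // mulr_natl -lnXn ?(lt_le_trans ltr01) //.
rewrite ler_ln ?posrE ?exprn_gt0 ?(lt_le_trans ltr01) // -?natrX.
  by rewrite ler_nat card_traces_le.
rewrite ler1n card_gt0; apply/set0Pn.
exists (neighbours G finset.set0 :&: ~: dt_cut st.1 st.2).
by apply/imsetP; exists finset.set0; rewrite // powersetE finset.sub0set.
Qed.

End BiholeFree.

(** * Probabilities in the random graph *)

Section Gnp.
Variables (R : realType) (n : nat) (p : R).

(** The potential edges outside S are summed out, each contributing a factor
    p + (1 - p) = 1. *)
Lemma gnp_prob_avoids (S : {set {set 'I_n}}) :
  (forall e, e \in S -> #|e| = 2%N) ->
  gnp_prob p (fun G : sgraph 'I_n => [disjoint val G & S]) = (1 - p) ^+ #|S|.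
Proof.
move=> S2.
pose F (e : {set 'I_n}) : R := if (#|e| == 2%N) && (e \notin S) then p else 0.
pose H (e : {set 'I_n}) : R := if #|e| == 2%N then 1 - p else 1.
(* Expanding this product over the edge sets, the sets which are not graphs or
   which meet S have a zero factor. *)
transitivity (\prod_(e : {set 'I_n}) (F e + H e)); last first.
  rewrite (bigID (mem S)) /= [X in _ * X]big1 ?mulr1 => [|e /negbTE eS].
    rewrite (eq_bigr (fun=> 1 - p)) ?prodr_const // => e eS.
    by rewrite /F /H eS S2 // eqxx andbF add0r.
  by rewrite /F /H eS andbT; case: ifP => _; rewrite ?add0r // addrC subrK.
rewrite bigA_distr.
rewrite (bigID (fun E : {set {set 'I_n}} =>
  [forall e in E, #|e| == 2%N] && [disjoint E & S])) /=.
rewrite [X in _ + X]big1 ?addr0; last first.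
  move=> E; rewrite negb_and => /orP[/forall_inPn[e eE /negbTE ne]|].
    by rewrite (bigD1 e) //= eE /F ne mul0r.
  move=> /pred0Pn[e /andP[/= eE eS]].
  by rewrite (bigD1 e) //= eE /F eS andbF mul0r.
rewrite /gnp_prob.
rewrite [RHS](reindex_omap (val : sgraph 'I_n -> _) insub); last first.
  by move=> E /andP[hE _]; rewrite insubT.
apply: eq_big => [G|G GS]; first by rewrite (valP G) valK eqxx andbT.
rewrite /gnp_pmf big_mkcond /=; apply: eq_bigr => e _; rewrite /F /H.
have [eG|//] := boolP (e \in val G).
have /forall_inP/(_ _ eG) -> := valP G.
by rewrite (disjointFr GS eG).
Qed.

Hypothesis p01 : 0 < p < 1.

Lemma gnp_pmf_ge0 (G : sgraph 'I_n) : 0 <= gnp_pmf p G.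
Proof.
case/andP: p01 => p0 p1; apply: prodr_ge0 => e _.
by case: ifP; rewrite ?subr_ge0 ltW.
Qed.

Lemma gnp_prob_le (P Q : pred (sgraph 'I_n)) :
  (forall G, P G -> Q G) -> gnp_prob p P <= gnp_prob p Q.
Proof.
move=> PQ; rewrite /gnp_prob [leLHS]big_mkcond [leRHS]big_mkcond /=.
apply: ler_sum => G _; have [/PQ ->//|_] := boolP (P G).
by case: ifP => // _; exact: gnp_pmf_ge0.
Qed.

Lemma gnp_probC (P : pred (sgraph 'I_n)) :
  gnp_prob p (fun G => ~~ P G) = 1 - gnp_prob p P.
Proof.
rewrite -(gnp_prob1 n p) /gnp_prob [\sum_(G | true) _](bigID P) /=.
by rewrite addrC addrK.
Qed.

Lemma gnp_prob_exists_le (I : finType) (P : I -> pred (sgraph 'I_n)) :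
  gnp_prob p (fun G => [exists i, P i G]) <= \sum_i gnp_prob p (P i).
Proof.
rewrite /gnp_prob; under [leRHS]eq_bigr do rewrite big_mkcond /=.
rewrite exchange_big /= big_mkcond; apply: ler_sum => G _.
have summand_ge0 i : 0 <= if P i G then gnp_pmf p G else 0.
  by case: ifP => // _; exact: gnp_pmf_ge0.
case: ifP => [/existsP[i PiG]|_]; last exact: sumr_ge0.
by rewrite (bigD1 i) //= PiG lerDl sumr_ge0.
Qed.

Lemma gnp_prob_bihole_le k :
  gnp_prob p (@has_bihole 'I_n k) <= (n%:R ^+ 2 * (1 - p) ^+ k) ^+ k.
Proof.
case/andP: p01 => p0 p1; have q0 : 0 <= 1 - p by rewrite subr_ge0 ltW.
pose ksets := [set X : {set 'I_n} | #|X| == k].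
pose pairs := finset.setX ksets ksets.
apply: le_trans (gnp_prob_exists_le _ (fun XY G => is_bihole k G XY)) _.
rewrite (bigID (mem pairs)) /= [X in _ + X]big1 ?addr0; last first.
  move=> XY; rewrite !inE negb_and => not_k; apply: big1 => G.
  by rewrite /is_bihole; case/and4P => Xk Yk; rewrite Xk Yk in not_k.
apply: (@le_trans _ _ (\sum_(XY in pairs) (1 - p) ^+ (k * k))).
  apply: ler_sum => -[X Y]; rewrite !inE => /andP[/= /eqP Xk /eqP Yk].
  have [dXY|ndXY] := boolP [disjoint X & Y]; last first.
    rewrite [leLHS]big1 ?exprn_ge0 // => G.
    by rewrite /is_bihole /= (negbTE ndXY) !andbF.
  have <- : #|cross_pairs X Y| = (k * k)%N by rewrite card_cross_pairs // Xk Yk.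
  rewrite -gnp_prob_avoids => [|e]; last exact: card_cross_pair.
  by apply: gnp_prob_le => G /and4P[].
rewrite sumr_const cardsX card_draws card_ord -[leLHS]mulr_natl exprMn -!exprM.
rewrite ler_wpM2r ?exprn_ge0 // natrM mul2n -addnn exprD -!natrX.
by rewrite ler_pM // ler_nat bin_le_expn.
Qed.

(** Of the three factors 1/n in (1 - p)^k <= n^-3, two pay for the choice of a
    vertex on each side of the bihole, and one is left over. *)
Lemma gnp_prob_no_bihole_ge k : (1 < n)%N -> (0 < k)%N ->
  3 * ln n%:R <= p * k%:R ->
  1 - n%:R^-1 <= gnp_prob p (fun G : sgraph 'I_n => ~~ has_bihole k G).
Proof.
case/andP: p01 => p0 p1 n2 k0 kln; have q0 : 0 <= 1 - p by rewrite subr_ge0 ltW.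
have n0 : 0 < n%:R :> R by rewrite ltr0n ltnW.
rewrite gnp_probC lerB //; apply: le_trans (gnp_prob_bihole_le k) _.
have base_le : n%:R ^+ 2 * (1 - p) ^+ k <= n%:R^-1.
  have qk : (1 - p) ^+ k <= (n%:R ^+ 3)^-1.
    apply: (@le_trans _ _ (expR (- p) ^+ k)).
      by rewrite lerXn2r ?nnegrE ?expR_ge0 ?expR_ge1Dx.
    rewrite -expRM_natr mulNr expRN lef_pV2 ?posrE ?exprn_gt0 ?expR_gt0 //.
    apply: (@le_trans _ _ (expR (3 * ln n%:R))); last by rewrite ler_expR.
    by rewrite expRM_natl lnK.
  apply: le_trans (ler_wpM2l (exprn_ge0 _ (ltW n0)) qk) _.
  by rewrite (exprSr _ 2) invfM mulrA divff ?mul1r // expf_neq0 ?gt_eqF.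
apply: le_trans (lerXn2r _ _ _ base_le) _; rewrite ?nnegrE.
- by rewrite mulr_ge0 ?exprn_ge0.
- by rewrite invr_ge0.
rewrite -[leRHS]expr1 ler_wiXn2l ?invr_ge0 ?invf_le1 ?ler1n //.
exact: ltnW.
Qed.

End Gnp.

(** * The almost sure bound *)

Local Open Scope classical_set_scope.
Local Open Scope ring_scope.

Theorem theorem1 (R : realType) :
  exists2 C : R, 0 < C &
    forall p : R, 0 < p < 1 ->
      (fun n : nat =>
         gnp_prob p
           (fun G : sgraph 'I_n => boolw R G <= C * (ln (n%:R : R) ^+ 2 / p)))
        @ \oo --> (1 : R).
Proof.
have ln2_gt0 : 0 < ln 2 :> R by rewrite ln_gt0 // ltr1n.
(* As p <= 1 and ln 2 <= ln n, the k + 1 <= 3 ln n / p + 2 of the choice of k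
   below is at most (3 + 2 / ln 2) ln n / p. *)
exists ((3 + 2 / ln 2) / ln 2) => [|p p01].
  by rewrite divr_gt0 // addr_gt0 // divr_gt0.
have /andP[p0 p1] := p01.
apply: (squeeze_cvgr (f := fun n => 1 - n%:R^-1) (h := fun=> 1)).
- near=> n; have n2 : (1 < n)%N by near: n; exact: nbhs_infty_gt.
  apply/andP; split; last first.
    by rewrite -[leRHS](gnp_prob1 n p); exact: gnp_prob_le.
  have n0 : 0 < n%:R :> R by rewrite ltr0n ltnW.
  have lnn : ln 2 <= ln n%:R :> R by rewrite ler_ln ?posrE // ler_nat.
  have lnp_ge0 : 0 <= 3 * ln n%:R / p.
    by rewrite divr_ge0 ?ltW // mulr_gt0 // (lt_le_trans ln2_gt0).
  pose k := (Num.truncn (3 * ln n%:R / p)).+1.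
  have k_ge : 3 * ln n%:R <= p * k%:R.
    by rewrite [leRHS]mulrC -ler_pdivrMr // ltW // truncnS_gt.
  have k_le : k.+1%:R <= (3 + 2 / ln 2) * (ln n%:R / p).
    rewrite mulrDl mulrA /k -(addn2 (Num.truncn _)) natrD lerD //.
      by case/andP: (truncn_itv lnp_ge0).
    rewrite -mulrA ler_pMr // mulrA ler_pdivlMr // mul1r.
    by apply: le_trans (ltW p1) _; rewrite ler_pdivlMl // mulr1.
  apply: le_trans (gnp_prob_no_bihole_ge _ _ _ p01 _ n2 _ k_ge) _ => //.
  apply: gnp_prob_le => // G /boolw_no_bihole/(_ R).
  rewrite card_ord => /(_ n2) /le_trans; apply.
  rewrite [leRHS]mulrAC ler_pM2r ?invr_gt0 // expr2 [_ * _ / p]mulrAC mulrA.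
  by rewrite ler_wpM2r // (le_trans (ltW ln2_gt0)).
- rewrite -[X in _ --> X]subr0; apply: cvgB; first exact: cvg_cst.
  by rewrite -cvg_shiftS; exact: cvg_harmonic.
- exact: cvg_cst.
Unshelve. all: by end_near.
Qed.
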